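(* Let $K\ge1$ be an integer. Then $$\inf_{\substack{P(1)=1\\ \deg P\le K}}\ \max_{|u|=1}\ |(u-1)P(u)|\ =\ \frac2{K+1},$$ where the infimum is over polynomials $P$ (with complex coefficients) with $P(1)=1$ and $\deg P\le K$, and it is attained by the Fejér polynomial $P^\star(u)=\frac1{K+1}\sum_{i=0}^{K}u^i$. *)

(* Defs.v *)
From HB Require Import structures.
From mathcomp Require Import all_boot all_order all_algebra.
From mathcomp Require Import all_classical all_reals all_analysis.
From mathcomp Require Import complex.
From mathcomp Require Import ring lra.

Set Implicit Arguments.
Unset Strict Implicit.
Unset Printing Implicit Defensive.

Import Order.TTheory GRing.Theory Num.Theory.
Import numFieldNormedType.Exports.
Import ComplexField.Normc.

Local Open Scope classical_set_scope.
Local Open Scope ring_scope.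
Local Open Scope complex_scope.

(* On R[i] the norm `|z| is itself an element of R[i], namely (normc z)%:C;
   normc z is the same modulus as an element of R. *)
Definition circle_values (R : realType) (f : R[i] -> R[i]) : set R :=
  [set normc (f u) | u in [set u : R[i] | `|u| = 1]].

(* The supremum is an attained maximum when f is a polynomial function:
   see circle_max_attained. *)
Definition circle_max (R : realType) (f : R[i] -> R[i]) : R :=
  sup (circle_values f).

Definition admissible (R : realType) (K : nat) : set {poly R[i]} :=
  [set P : {poly R[i]} | P.[1] = 1 /\ (size P <= K.+1)%N].

Definition fejer (R : realType) (K : nat) : {poly R[i]} :=
  (K.+1%:R)^-1 *: \sum_(i < K.+1) 'X^i.

Arguments admissible : clear implicits.
Arguments fejer : clear implicits.

Lemma circle_param (R : realType) (u : R[i]) : `|u| = 1 ->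
  exists2 t : R, t \in `[(- pi : R), pi]%R & u = (cos t +i* sin t)%C.
Proof.
case: u => x y; rewrite normc_def /= => -[hs].
have e1 : x ^+ 2 + y ^+ 2 = 1.
  by rewrite -(@sqr_sqrtr R (x ^+ 2 + y ^+ 2)) ?addr_ge0 ?sqr_ge0// hs expr1n.
have xB : -1 <= x <= 1 by apply/andP; split; nra.
have [/andP[a0 api] ca] := acos_def xB.
have sa : sin (acos x) = `|y|.
  by rewrite sin_acos// -e1 addrAC subrr add0r sqrtr_sqr.
have [y0|y0] := leP 0 y.
- exists (acos x); last by rewrite ca sa ger0_norm.
  by rewrite in_itv /= api andbT (le_trans _ a0)// oppr_le0 pi_ge0.
- exists (- acos x); last by rewrite cosN sinN ca sa ltr0_norm// opprK.
  by rewrite in_itv /= lerN2 api /= (le_trans _ (pi_ge0 R))// oppr_le0.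
Qed.

Lemma circle_continuous (R : realType) (p : {poly R[i]}) :
  continuous (fun t : R => normc p.[(cos t +i* sin t)%C]).
Proof.
have [cR cI] : continuous (fun t : R => complex.Re p.[(cos t +i* sin t)%C]) /\
    continuous (fun t : R => complex.Im p.[(cos t +i* sin t)%C]).
  elim/poly_ind: p => [|p [a b] [IHr IHi]].
    by split=> t; under [X in continuous_at _ X]eq_fun do rewrite horner0 /=;
      exact: cvg_cst.
  split=> t.
  - rewrite (_ : (fun _ => _) = (fun t : R =>
        complex.Re p.[(cos t +i* sin t)%C] * cos t -
        complex.Im p.[(cos t +i* sin t)%C] * sin t + a)); last first.
      by apply/funext => s; rewrite hornerMXaddC; case: p.[_].
    apply: cvgD; last exact: cvg_cst.
    apply: cvgB; apply: cvgM;
      [exact: IHr | exact: continuous_cos | exact: IHi | exact: continuous_sin].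
  - rewrite (_ : (fun _ => _) = (fun t : R =>
        complex.Re p.[(cos t +i* sin t)%C] * sin t +
        complex.Im p.[(cos t +i* sin t)%C] * cos t + b)); last first.
      by apply/funext => s; rewrite hornerMXaddC; case: p.[_].
    apply: cvgD; last exact: cvg_cst.
    apply: cvgD; apply: cvgM;
      [exact: IHr | exact: continuous_sin | exact: IHi | exact: continuous_cos].
move=> t.
rewrite (_ : (fun _ => _) = (fun t : R => Num.sqrt
     (complex.Re p.[(cos t +i* sin t)%C] * complex.Re p.[(cos t +i* sin t)%C] +
      complex.Im p.[(cos t +i* sin t)%C] * complex.Im p.[(cos t +i* sin t)%C])));
  last by apply/funext => s; case: p.[_].
apply: (@continuous_cvg _ _ _ _ _ _ (@Num.sqrt R)); first exact: sqrt_continuous.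
by apply: cvgD; apply: cvgM; (exact: cR || exact: cI).
Qed.

Lemma circle_max_attained (R : realType) (p : {poly R[i]}) :
  circle_values (fun u => p.[u]) (circle_max (fun u => p.[u])) /\
  ubound (circle_values (fun u => p.[u])) (circle_max (fun u => p.[u])).
Proof.
have [|c _ cmax] := @EVT_max R (fun t : R => normc p.[(cos t +i* sin t)%C])
  (- pi) pi _ (continuous_subspaceT (@circle_continuous R p)).
  by rewrite (le_trans _ (pi_ge0 R))// oppr_le0 pi_ge0.
set M := normc p.[(cos c +i* sin c)%C] in cmax.
have VM : circle_values (fun u => p.[u]) M.
  exists (cos c +i* sin c)%C => //=.
  by rewrite normc_def /= cos2Dsin2 sqrtr1.
have UM : ubound (circle_values (fun u => p.[u])) M.
  by move=> _ [u /circle_param[t tI ->] <-]; exact: cmax.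
suff -> : circle_max (fun u => p.[u]) = M by [].
apply/eqP; rewrite eq_le; apply/andP; split.
- by apply: ge_sup => //; exists M.
- by apply: ub_le_sup => //; exists M.
Qed.

(* Main.v *)
(** Let n = K + 1 and D(u) = 1 + u + ... + u^(n-1).  Averaging over the n roots
    w of w^n = -1 is an exact quadrature for the coefficient pairing of
    polynomials of degree < n, so n P(1) = sum_w P(w) conj(D(w)), and in
    particular sum_w |D(w)|^2 = n^2.  At these roots (w - 1) D(w) = -2, hence
    |P(w)| = |(w - 1) P(w)| |D(w)| / 2.  If |(u - 1) P(u)| <= M on the unit
    circle, it follows that n |P(1)| <= (M / 2) n^2.  The Fejer polynomial
    D / n gives |u^n - 1| / n <= 2 / n, so the bound is sharp. *)

Require Import Defs.
From mathcomp Require Import all_boot all_order all_algebra.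
From mathcomp Require Import all_classical all_reals all_analysis.
From mathcomp Require Import complex.
From mathcomp Require Import ring lra.

Import Order.TTheory GRing.Theory Num.Theory.

Local Open Scope classical_set_scope.
Local Open Scope ring_scope.
Local Open Scope complex_scope.

(** A geometric sum whose ratio [z ^+ a / z ^+ b] is an [n]-th root of unity. For [a != b] the ratio
    differs from 1, and multiplying the sum by ratio minus 1 telescopes to 0. *)
Lemma sum_prim_root_expr (F : fieldType) (n : nat) (z : F) (a b : nat) :
  n.-primitive_root z -> (a < n)%N -> (b < n)%N ->
  \sum_(k < n) (z ^+ k) ^+ a / (z ^+ k) ^+ b = (n * (a == b))%:R.
Proof.
move=> zP an bn; have n0 := prim_order_gt0 zP.
have z0 : z != 0 by rewrite (prim_root_eq0 zP) -lt0n.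
under eq_bigr do
  rewrite -!exprM ![(_ * a)%N]mulnC ![(_ * b)%N]mulnC !exprM -exprVn -exprMn.
have [->|ab] := eqVneq a b.
  rewrite muln1 divff ?expf_neq0//.
  by under eq_bigr do rewrite expr1n; rewrite sumr_const card_ord.
have q1 : z ^+ a / z ^+ b - 1 != 0.
  rewrite subr_eq0 -(inj_eq (mulIf (expf_neq0 b z0))) divfK ?expf_neq0// mul1r.
  by rewrite (eq_prim_root_expr zP) !modn_small.
apply: (mulfI q1); rewrite -subrX1 muln0 mulr0 exprMn exprVn -!exprM.
rewrite ![(_ * n)%N]mulnC !exprM (prim_expr_order zP) !expr1n.
by rewrite invr1 mulr1 subrr.
Qed.

(** Orthogonality leaves only the diagonal terms, where the powers of [w] cancel; each coefficient
    of [P] is then counted [n] times. *)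
Lemma sum_horner_dirichlet (F : fieldType) (n : nat) (w z : F) (P : {poly F}) :
  w != 0 -> n.-primitive_root z -> (size P <= n)%N ->
  \sum_(k < n) P.[w * z ^+ k] * (\sum_(j < n) (w * z ^+ k) ^- j) = n%:R * P.[1].
Proof.
move=> w0 zP sP.
under eq_bigr do rewrite (horner_coef_wide _ sP) big_distrlr /=.
rewrite exchange_big /= (horner_coef_wide _ sP) mulr_sumr; apply: eq_bigr => i _.
rewrite exchange_big /= (bigD1 i)//= [X in _ + X]big1 => [|j ji].
  rewrite addr0 expr1n mulr1 mulr_natl.
  transitivity (\sum_(k < n) P`_i); last by rewrite sumr_const card_ord.
  apply: eq_bigr => k _; rewrite -mulrA divff ?mulr1// expf_neq0// mulf_neq0//.
  by rewrite expf_neq0// (prim_root_eq0 zP) -lt0n (prim_order_gt0 zP).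
transitivity (P`_i * (w ^+ i / w ^+ j) *
    \sum_(k < n) (z ^+ k) ^+ i / (z ^+ k) ^+ j).
  by rewrite mulr_sumr; apply: eq_bigr => k _; rewrite !exprMn invfM; ring.
rewrite (sum_prim_root_expr _ _ _ _ _ zP)//.
by rewrite eq_sym (inj_eq val_inj) (negbTE ji) muln0 mulr0.
Qed.

Lemma horner1_le_circle_bound (C : numClosedFieldType) (n : nat) (z : C)
    (P : {poly C}) (M : C) :
  n.-primitive_root z -> (size P <= n)%N ->
  (forall u, `|u| = 1 -> `|(u - 1) * P.[u]| <= M) ->
  2 / n%:R * `|P.[1]| <= M.
Proof.
move=> zP sP PM; have n0 := prim_order_gt0 zP.
(* Rotating the [n]-th roots of unity by [w] gives nodes [om k] with [om k ^+ n = -1], the points of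
   the circle where [u ^+ n - 1] has its largest modulus, 2. *)
pose w : C := n.-root (-1).
have wn : w ^+ n = -1 by rewrite /w rootCK.
have w0 : w != 0.
  apply: contra_eq_neq wn => ->.
  by rewrite expr0n gtn_eqF// eq_sym oppr_eq0 oner_eq0.
pose om (k : 'I_n) := w * z ^+ k.
have omn k : om k ^+ n = -1.
  by rewrite /om exprMn wn exprAC (prim_expr_order zP) expr1n mulr1.
have om1 k : `|om k| = 1.
  by apply/eqP; rewrite -(@pexpr_eq1 _ _ n)// -normrX omn normrN1.
pose D k := \sum_(j < n) om k ^- j.
(* On the unit circle inversion is conjugation, so [D k] is the conjugate of the Dirichlet sum at
   [om k]. *)
have conjD k : Num.conj (D k) = \sum_(j < n) om k ^+ j.
  rewrite /D rmorph_sum; apply: eq_bigr => j _ /=.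
  by rewrite -exprVn rmorphXn invC_norm om1 expr1n invr1 mul1r /= conjCK.
have D2 k : `|om k - 1| * `|D k| = 2.
  rewrite -norm_conjC -normrM conjD -subrX1 omn.
  by rewrite -opprD normrN -[1 + 1]/(2%:R) normr_nat.
(* The quadrature applied to the Dirichlet polynomial itself, whose value at 1 is [n]. *)
have sumD : \sum_k `|D k| ^+ 2 = n%:R * n%:R.
  have sX : (size (\sum_(j < n) 'X^j : {poly C})%R <= n)%N.
    apply: (leq_trans (size_sum _ _ _)).
    by apply/bigmax_leqP => j _; rewrite size_polyXn.
  have := sum_horner_dirichlet _ _ _ _ _ w0 zP sX.
  rewrite !horner_sum; under [X in _ * X]eq_bigr do rewrite hornerXn expr1n.
  rewrite sumr_const card_ord => <-; apply: eq_bigr => k _.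
  rewrite normCKC conjD horner_sum; congr (_ * _).
  by apply: eq_bigr => j _; rewrite hornerXn.
have PD k : `|P.[om k] * D k| <= M / 2 * `|D k| ^+ 2.
  have := PM _ (om1 k); rewrite !normrM => h.
  have -> : `|P.[om k]| * `|D k| =
      `|om k - 1| * `|P.[om k]| * (`|D k| ^+ 2 / 2).
    rewrite -{1}[`|D k|](mulfK (_ : 2 != 0 :> C)) ?pnatr_eq0//.
    by rewrite -{1}(D2 k); ring.
  by rewrite [leRHS]mulrAC -[leRHS]mulrA; apply: ler_wpM2r.
have nR : 0 < n%:R :> C by rewrite ltr0n.
have : n%:R * `|P.[1]| <= M / 2 * (n%:R * n%:R).
  rewrite -[X in X * `|_|]normr_nat -normrM -sumD.
  rewrite -(sum_horner_dirichlet _ _ _ _ _ w0 zP sP) mulr_sumr.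
  apply: (le_trans (ler_norm_sum _ _ _)).
  by apply: ler_sum => k _; exact: PD.
rewrite [leRHS]mulrCA ler_pM2l// => h.
rewrite mulrAC ler_pdivrMr//.
by rewrite mulrC -ler_pdivlMr// mulrAC.
Qed.

Lemma cos_sin_expr (R : realType) (t : R) (m : nat) :
  (cos t +i* sin t) ^+ m = cos (m%:R * t) +i* sin (m%:R * t).
Proof.
elim: m => [|m IH]; first by rewrite mul0r cos0 sin0.
by rewrite exprS IH -natr1 mulrDl mul1r addrC cosD sinD; congr (_ +i* _); ring.
Qed.

Lemma complex_prim_root (R : realType) (n : nat) : (0 < n)%N ->
  exists z : R[i], n.-primitive_root z.
Proof.
move=> n0; have nR : 0 < n%:R :> R by rewrite ltr0n.
(* Half the argument of the root: for [0 < m < n] the angle [m * t] lies in []0, pi[], so its sine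
   is positive and [cos (2 * m * t) < 1]. *)
pose t : R := pi / n%:R.
exists (cos (t *+ 2) +i* sin (t *+ 2)).
apply/andP; split => //; apply/forallP => i.
rewrite unity_rootE cos_sin_expr eq_complex /= mulrnAr.
have [->|ne] := eqVneq i.+1 n.
  by rewrite /t mulrC divfK ?lt0r_neq0// cos2pi sin2pi !eqxx.
have s0 : 0 < sin (i.+1%:R * t).
  have in0 : i.+1%:R < n%:R :> R by rewrite ltr_nat ltn_neqAle ne ltn_ord.
  apply: sin_gt0_pi; rewrite mulr_gt0 ?ltr0n ?divr_gt0 ?pi_gt0//=.
  by rewrite mulrCA gtr_pMr ?pi_gt0// ltr_pdivrMr// mul1r.
apply/eqP/negbTE; rewrite negb_and; apply/orP; left.
have := cos2Dsin2 (i.+1%:R * t); rewrite cos_mulr2n; nra.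
Qed.

(** Packs the product into a single polynomial, the form that [circle_max_attained] handles. *)
Lemma circle_maxE (R : realType) (P : {poly R[i]}) :
  circle_max (fun u => (u - 1) * P.[u]) =
  circle_max (fun u => (('X - 1%:P) * P).[u]).
Proof. by congr circle_max; apply/funext => u; rewrite hornerM hornerXsubC. Qed.

Lemma circle_max_ge (R : realType) (n : nat) (P : {poly R[i]}) :
  (0 < n)%N -> P.[1] = 1 -> (size P <= n)%N ->
  2 / n%:R <= circle_max (fun u => (u - 1) * P.[u]).
Proof.
move=> n0 P1 sP; have [z zP] := complex_prim_root R n n0.
have [_ ub] := circle_max_attained (('X - 1%:P) * P).
(* Norms on [R[i]] take values in [R[i]], so the real maximum is embedded by [%:C] and the
   inequality is brought back with [lecR]. *)
have := horner1_le_circle_bound _ _ _ _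
  (circle_max (fun u => (('X - 1%:P) * P).[u]))%:C zP sP.
rewrite P1 normr1 mulr1 circle_maxE -lecR rmorphM fmorphV !rmorph_nat; apply.
move=> u u1; rewrite lecR; apply: ub; exists u => //.
by rewrite hornerM hornerXsubC.
Qed.

Lemma horner_fejer (R : realType) (K : nat) (u : R[i]) :
  (u - 1) * (fejer R K).[u] = (u ^+ K.+1 - 1) / K.+1%:R.
Proof.
rewrite /fejer hornerZ horner_sum mulrCA; under eq_bigr do rewrite hornerXn.
by rewrite -subrX1 mulrC.
Qed.

Lemma admissible_fejer (R : realType) (K : nat) : admissible R K (fejer R K).
Proof.
split.
  rewrite /fejer hornerZ horner_sum; under eq_bigr do rewrite hornerXn expr1n.
  by rewrite sumr_const card_ord mulVf// pnatr_eq0.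
apply: (leq_trans (size_scale_leq _ _)); apply: (leq_trans (size_sum _ _ _)).
by apply/bigmax_leqP => j _; rewrite size_polyXn.
Qed.

Lemma circle_max_fejer (R : realType) (K : nat) :
  circle_max (fun u => (u - 1) * (fejer R K).[u]) = 2 / K.+1%:R.
Proof.
have [P1 sP] := admissible_fejer R K.
apply/eqP; rewrite eq_le circle_max_ge// andbT circle_maxE.
(* Since the maximum is attained at some [u], the triangle inequality at that point suffices. *)
have [[u /= u1 <-] _] := circle_max_attained (('X - 1%:P) * fejer R K).
rewrite hornerM hornerXsubC horner_fejer -lecR.
rewrite rmorphM fmorphV !rmorph_nat -[leLHS]/`|(u ^+ K.+1 - 1) / K.+1%:R|.
rewrite normrM normfV normr_nat ler_wpM2r ?invr_ge0 ?ler0n//.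
by rewrite (le_trans (ler_normB _ _))// normrX u1 expr1n normr1.
Qed.

Theorem theorem4p7 (R : realType) (K : nat) (hK : (1 <= K)%N) :
  inf [set circle_max (fun u : R[i] => (u - 1) * P.[u])
      | P in admissible R K] = 2 / K.+1%:R
  /\ admissible R K (fejer R K)
  /\ circle_max (fun u : R[i] => (u - 1) * (fejer R K).[u]) = 2 / K.+1%:R.
Proof.
split; last by split; [exact: admissible_fejer | exact: circle_max_fejer].
set S := (X in inf X).
have lbS : lbound S (2 / K.+1%:R).
  by move=> _ [P [P1 sP] <-]; exact: circle_max_ge.
have SF : S (2 / K.+1%:R).
  by exists (fejer R K); [exact: admissible_fejer | exact: circle_max_fejer].
(* [inf] is meaningful only for a nonempty set bounded below: the same value serves first as lower
   bound, then as element. *)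
apply/eqP; rewrite eq_le; apply/andP; split.
- by apply: ge_inf => //; exists (2 / K.+1%:R).
- by apply: lb_le_inf => //; exists (2 / K.+1%:R).
Qed.
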